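(* Suppose $\{S_n\}_{n=0}^\infty$ is a positive log-convex sequence of real numbers that satisfies the recurrence relation $$S_n=b(n)S_{n-1}+c(n)S_{n-2}$$ for $n\ge 2$, where $b(n),c(n)$ are real-valued functions of $n$. Let \begin{align*} a_3(n)=&\,2b(n+2)b^2(n+1)+2b(n+1)c(n+2)-b^3(n+1)\\ &-b(n+1)b(n+2)b(n+3)-b(n+3)c(n+2)-c(n+3)b(n+1),\\ a_2(n)=&\,4b(n+1)b(n+2)c(n+1)+2c(n+1)c(n+2)+b^2(n+1)b(n+2)b(n+3)\\ &+b(n+1)b(n+3)c(n+2)+b^2(n+1)c(n+3)-3c(n+1)b^2(n+1)\\ &-b(n+3)b(n+2)c(n+1)-c(n+3)c(n+1)-b^2(n+2)b^2(n+1)\\ &-2b(n+2)b(n+1)c(n+2)-c^2(n+2),\\ a_1(n)=&-c(n+1)\big(2b(n+2)c(n+2)-2b(n+2)c(n+1)-2b(n+3)b(n+2)b(n+1)\\ &-b(n+3)c(n+2)-2c(n+3)b(n+1)+3c(n+1)b(n+1)+2b^2(n+2)b(n+1)\big),\\ a_0(n)=&-c^2(n+1)\left(c(n+1)-b(n+2)b(n+3)-c(n+3)+b^2(n+2)\right) \end{align*} and $$\Delta(n)=4a_2^2(n)-12a_1(n)a_3(n).$$ Assume that $a_3(n)<0$ and $\Delta(n)>0$ for all $n\ge N$, where $N$ is a positive integer. If there exist real numbers $f_n$ and $g_n$ such that for all $n\ge N$, (1) $f_n\le \dfrac{S_n}{S_{n-1}}<g_n$; (2) $f_n\ge \dfrac{-2a_2(n)-\sqrt{\Delta(n)}}{6a_3(n)}$;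 (3) $a_3(n)g_n^3+a_2(n)g_n^2+a_1(n)g_n+a_0(n)>0$, then $\{S_n\}_{n=N}^\infty$ is strictly 2-log-convex, that is, for all $n\ge N$, $$\left(S_{n-1}S_{n+1}-S_n^2\right)\left(S_{n+1}S_{n+3}-S_{n+2}^2\right)>\left(S_nS_{n+2}-S_{n+1}^2\right)^2.$$
   Context: A positive sequence $\{a_n\}_{n=0}^\infty$ is log-convex if $a_n^2\le a_{n-1}a_{n+1}$ for all $n\ge 1$. Notation such as $b^2(n+1)$ means $(b(n+1))^2$, and similarly for other powers. *)

(* Defs.v *)
From Stdlib Require Import Reals.
Open Scope R_scope.

Definition positive_seq (s : nat -> R) : Prop := forall n : nat, 0 < s n.

Definition log_convex (s : nat -> R) : Prop :=
  forall n : nat, (1 <= n)%nat -> s n ^ 2 <= s (n - 1)%nat * s (n + 1)%nat.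

(* Strict 2-log-convexity of the tail (s_n)_{n >= N}. The index n - 1 is a
   truncated subtraction, so this is meant for N >= 1. *)
Definition strictly_2_log_convex_from (N : nat) (s : nat -> R) : Prop :=
  forall n : nat, (N <= n)%nat ->
    (s (n - 1)%nat * s (n + 1)%nat - s n ^ 2) *
      (s (n + 1)%nat * s (n + 3)%nat - s (n + 2)%nat ^ 2) >
    (s n * s (n + 2)%nat - s (n + 1)%nat ^ 2) ^ 2.

(* When s satisfies s_n = b(n) s_{n-1} + c(n) s_{n-2} and x = s_n / s_{n-1},
   the difference of the two sides in strictly_2_log_convex_from is
   s_{n+1} s_{n-1}^3 (a3(n) x^3 + a2(n) x^2 + a1(n) x + a0(n)). *)
Definition a3 (b c : nat -> R) (n : nat) : R :=
  let b1 := b (n + 1)%nat in let b2 := b (n + 2)%nat in let b3 := b (n + 3)%nat in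
  let c2 := c (n + 2)%nat in let c3 := c (n + 3)%nat in
  2 * b2 * b1 ^ 2 + 2 * b1 * c2 - b1 ^ 3
  - b1 * b2 * b3 - b3 * c2 - c3 * b1.

Definition a2 (b c : nat -> R) (n : nat) : R :=
  let b1 := b (n + 1)%nat in let b2 := b (n + 2)%nat in let b3 := b (n + 3)%nat in
  let c1 := c (n + 1)%nat in let c2 := c (n + 2)%nat in let c3 := c (n + 3)%nat in
  4 * b1 * b2 * c1 + 2 * c1 * c2 + b1 ^ 2 * b2 * b3
  + b1 * b3 * c2 + b1 ^ 2 * c3 - 3 * c1 * b1 ^ 2
  - b3 * b2 * c1 - c3 * c1 - b2 ^ 2 * b1 ^ 2
  - 2 * b2 * b1 * c2 - c2 ^ 2.

Definition a1 (b c : nat -> R) (n : nat) : R :=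
  let b1 := b (n + 1)%nat in let b2 := b (n + 2)%nat in let b3 := b (n + 3)%nat in
  let c1 := c (n + 1)%nat in let c2 := c (n + 2)%nat in let c3 := c (n + 3)%nat in
  - c1 * (2 * b2 * c2 - 2 * b2 * c1 - 2 * b3 * b2 * b1
          - b3 * c2 - 2 * c3 * b1 + 3 * c1 * b1 + 2 * b2 ^ 2 * b1).

Definition a0 (b c : nat -> R) (n : nat) : R :=
  let b2 := b (n + 2)%nat in let b3 := b (n + 3)%nat in
  let c1 := c (n + 1)%nat in let c3 := c (n + 3)%nat in
  - c1 ^ 2 * (c1 - b2 * b3 - c3 + b2 ^ 2).

Definition Delta_n (b c : nat -> R) (n : nat) : R :=
  4 * a2 b c n ^ 2 - 12 * a1 b c n * a3 b c n.

(* Main.v *)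
Require Import Defs.
From Stdlib Require Import Reals Lra Lia.
Open Scope R_scope.

(** Put [x = s n / s (n - 1)].  Eliminating [s (n + 3)], [s (n + 2)], [s (n + 1)]
    in turn by the recurrence makes the difference of the two sides of
    2-log-convexity a quartic form in [s n] and [s (n - 1)], and this form
    contains [s (n + 1)] as a factor.  The cofactor, divided by
    [s (n - 1) ^ 3], is the cubic [P x] with coefficients [a3], ..., [a0], so
    everything rests on the sign of [P x].

    As [a3 < 0], the derivative of [P] is a concave quadratic, and the lower
    bound imposed on [f n] is its larger critical point: dividing by the
    negative number [6 * a3] makes the root with [- sqrt Delta] the larger one.
    Hence [P] decreases to the right of [f n], and [f n <= x < g n] gives
    [P x >= P (g n) > 0] ([cubic_antitone_past_critical_point]). *)

(** The quantity [6 * A3 * r + 2 * A2] is the second derivative of the cubic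
    at its critical point [r]; when it is nonpositive and [A3 < 0], the
    second derivative stays nonpositive on the right of [r], and so does the
    first. *)
Lemma cubic_antitone_past_critical_point (A3 A2 A1 A0 r x y : R) :
  A3 < 0 -> 3 * A3 * r ^ 2 + 2 * A2 * r + A1 = 0 -> 6 * A3 * r + 2 * A2 <= 0 ->
  r <= x -> x <= y ->
  A3 * y ^ 3 + A2 * y ^ 2 + A1 * y + A0 <= A3 * x ^ 3 + A2 * x ^ 2 + A1 * x + A0.
Proof.
  intros hA3 hcrit hsecond hrx hxy.
  set (u := x - r). set (v := y - r).
  assert (hu : 0 <= u) by (unfold u; lra).
  assert (hv : 0 <= v) by (unfold v; lra).
  (* The divided difference of the cubic, expanded around [r]: its constant
     term is the derivative at [r], hence vanishes. *)
  assert (hdiff :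
    (A3 * y ^ 3 + A2 * y ^ 2 + A1 * y + A0)
      - (A3 * x ^ 3 + A2 * x ^ 2 + A1 * x + A0)
    = (y - x) * ((3 * A3 * r ^ 2 + 2 * A2 * r + A1)
                 + (6 * A3 * r + 2 * A2) * ((u + v) / 2)
                 + A3 * (u ^ 2 + u * v + v ^ 2)))
    by (unfold u, v; field).
  rewrite hcrit in hdiff.
  assert (hlin : (6 * A3 * r + 2 * A2) * ((u + v) / 2) <= 0) by nra.
  assert (hquad : A3 * (u ^ 2 + u * v + v ^ 2) <= 0).
  { assert (0 <= u * v) by nra.
    assert (0 <= u ^ 2 + u * v + v ^ 2) by nra.
    nra. }
  nra.
Qed.

Lemma cubic_critical_point (A3 A2 A1 D : R) :
  A3 <> 0 -> D = 4 * A2 ^ 2 - 12 * A1 * A3 -> 0 <= D ->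
  let r := (- 2 * A2 - sqrt D) / (6 * A3) in
  3 * A3 * r ^ 2 + 2 * A2 * r + A1 = 0 /\ 6 * A3 * r + 2 * A2 = - sqrt D.
Proof.
  intros hA3 hD hD0 r.
  assert (hsqrt : sqrt D ^ 2 = 4 * A2 ^ 2 - 12 * A1 * A3)
    by (rewrite <- hD; apply pow2_sqrt; exact hD0).
  split; unfold r.
  - replace (3 * A3 * ((- 2 * A2 - sqrt D) / (6 * A3)) ^ 2
             + 2 * A2 * ((- 2 * A2 - sqrt D) / (6 * A3)) + A1)
      with ((sqrt D ^ 2 - (4 * A2 ^ 2 - 12 * A1 * A3)) / (12 * A3))
      by (field; exact hA3).
    rewrite hsqrt. field. exact hA3.
  - field. exact hA3.
Qed.

(** Once the recurrence is unfolded down to [s n] and [s (n - 1)], this is a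
    polynomial identity; it explains where the coefficients [a3], ..., [a0]
    come from. *)
Lemma log_convexity_defect_eq_cubic (s b c : nat -> R) (n : nat) :
  (forall m : nat, (2 <= m)%nat ->
     s m = b m * s (m - 1)%nat + c m * s (m - 2)%nat) ->
  (1 <= n)%nat -> s (n - 1)%nat <> 0 ->
  let x := s n / s (n - 1)%nat in
  (s (n - 1)%nat * s (n + 1)%nat - s n ^ 2) *
    (s (n + 1)%nat * s (n + 3)%nat - s (n + 2)%nat ^ 2)
  - (s n * s (n + 2)%nat - s (n + 1)%nat ^ 2) ^ 2
  = s (n + 1)%nat * s (n - 1)%nat ^ 3 *
      (a3 b c n * x ^ 3 + a2 b c n * x ^ 2 + a1 b c n * x + a0 b c n).
Proof.
  intros hrec hn hp x.
  assert (h1 := hrec (n + 1)%nat ltac:(lia)).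
  assert (h2 := hrec (n + 2)%nat ltac:(lia)).
  assert (h3 := hrec (n + 3)%nat ltac:(lia)).
  replace (n + 1 - 1)%nat with n in h1 by lia.
  replace (n + 1 - 2)%nat with (n - 1)%nat in h1 by lia.
  replace (n + 2 - 1)%nat with (n + 1)%nat in h2 by lia.
  replace (n + 2 - 2)%nat with n in h2 by lia.
  replace (n + 3 - 1)%nat with (n + 2)%nat in h3 by lia.
  replace (n + 3 - 2)%nat with (n + 1)%nat in h3 by lia.
  rewrite h3, h2, h1.
  unfold x, a3, a2, a1, a0. cbv zeta.
  field. exact hp.
Qed.

Theorem theorem2p1
  (s b c : nat -> R) (N : nat)
  (hpos : positive_seq s)
  (hlc : log_convex s)
  (hrec : forall n : nat, (2 <= n)%nat ->
     s n = b n * s (n - 1)%nat + c n * s (n - 2)%nat)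
  (hN : (1 <= N)%nat)
  (ha3 : forall n : nat, (N <= n)%nat -> a3 b c n < 0)
  (hDelta : forall n : nat, (N <= n)%nat -> Delta_n b c n > 0)
  (hfg : exists f g : nat -> R, forall n : nat, (N <= n)%nat ->
     (f n <= s n / s (n - 1)%nat < g n) /\
     f n >= (- 2 * a2 b c n - sqrt (Delta_n b c n)) / (6 * a3 b c n) /\
     a3 b c n * g n ^ 3 + a2 b c n * g n ^ 2 + a1 b c n * g n + a0 b c n > 0) :
  strictly_2_log_convex_from N s.
Proof.
  intros n hn.
  destruct hfg as [f [g hfg]].
  destruct (hfg n hn) as [[hfx hxg] [hf hg]].
  specialize (ha3 n hn). specialize (hDelta n hn).
  assert (hprev := hpos (n - 1)%nat). assert (hnext := hpos (n + 1)%nat).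
  destruct (cubic_critical_point (a3 b c n) (a2 b c n) (a1 b c n) (Delta_n b c n))
    as [hcrit hsecond]; [lra | reflexivity | lra |].
  assert (hsqrt := sqrt_pos (Delta_n b c n)).
  set (r := (- 2 * a2 b c n - sqrt (Delta_n b c n)) / (6 * a3 b c n)) in *.
  assert (hanti := cubic_antitone_past_critical_point
    (a3 b c n) (a2 b c n) (a1 b c n) (a0 b c n) r (s n / s (n - 1)%nat) (g n)
    ha3 hcrit ltac:(lra) ltac:(lra) ltac:(lra)).
  apply Rminus_gt.
  rewrite (log_convexity_defect_eq_cubic s b c n hrec ltac:(lia) ltac:(lra)).
  apply Rmult_lt_0_compat; [| lra].
  apply Rmult_lt_0_compat; [exact hnext | exact (pow_lt _ 3 hprev)].
Qed.
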